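(* Let $$n=\sum_{i=1}^{s}\sum_{k=l_i}^{t_i}2^k,$$ where $s\ge1$ and $l_i,t_i$ are non-negative integers with $t_i\ge l_i$ for $1\le i\le s$ and $l_i-2\ge t_{i+1}$ for $1\le i<s$ (so $t_1\ge l_1>l_1-2\ge t_2\ge l_2>l_2-2\ge\dots\ge t_s\ge l_s\ge0$). Then, for every $i=1,2,\dots,s$, $$n|K_n(x)|\ge 2^{2t_i-2}\qquad\text{for all } x\in E_{t_i}:=I_{t_i+3}(e_{t_i+1}+e_{t_i+2}).$$
   Context: $G=\prod_{j=0}^\infty Z_2$, where $Z_2=\{0,1\}$ is the cyclic group of order 2; elements are $x=(x_0,x_1,\dots)$, addition is coordinatewise modulo 2. For $x\in G$, $I_0(x)=G$ and $I_n(x)=\{y\in G:y_0=x_0,\dots,y_{n-1}=x_{n-1}\}$. $e_n\in G$ is the element whose $n$-th coordinate is 1 and all other coordinates are 0. Walsh system: $r_k(x)=(-1)^{x_k}$; for $m=\sum_j m_j2^j$ with $m_j\in\{0,1\}$, $w_m(x)=\prod_{k=0}^\infty r_k(x)^{m_k}$. Dirichlet and Fejér kernels: $D_n=\sum_{k=0}^{n-1}w_k$ and $K_n=\frac1n\sum_{k=1}^nD_k$ for $n\ge1$. *)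

(* Defs.v *)
(* functions.v equips nat -> 'Z_2 with its pointwise group structure. *)
From mathcomp Require Export all_boot all_order all_algebra.
From mathcomp Require Export boolp classical_sets functions fsbigop reals.
Set Implicit Arguments.
Unset Strict Implicit.
Unset Printing Implicit Defensive.
Import Order.TTheory GRing.Theory Num.Theory.
Local Open Scope classical_set_scope.
Local Open Scope ring_scope.

Notation dyadic := (nat -> 'Z_2).

Lemma dyadic_addE (x y : dyadic) j : (x + y) j = x j + y j.
Proof. by []. Qed.

Definition dyadic_unit (n : nat) : dyadic := fun j => (j == n)%:R.

Definition dyadic_itv (n : nat) (x : dyadic) : set dyadic :=
  [set y | forall j, (j < n)%N -> y j = x j].

Definition digit (m j : nat) : nat := odd (m %/ 2 ^ j).

Lemma digit_lt2 m j : (digit m j < 2)%N.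
Proof. by rewrite /digit; case: odd. Qed.

Lemma digit_expansion m N : (m < 2 ^ N)%N ->
  m = (\sum_(j < N) digit m j * 2 ^ j)%N.
Proof.
elim: N m => [|N IHN] m; first by rewrite big_ord0 expn0; case: m.
move=> mN; rewrite big_ord_recl /digit expn0 divn1 muln1.
have hN : (m %/ 2 < 2 ^ N)%N by rewrite ltn_divLR // mulnC -expnS.
rewrite [LHS](divn_eq m 2) modn2 addnC {1}(IHN _ hN) big_distrl /=.
congr addn; apply: eq_bigr => i _.
by rewrite /digit /bump /= add1n expnS divnMA mulnA -mulnA [(2 ^ i * 2)%N]mulnC mulnA.
Qed.

Section Walsh.
Variable R : realType.

Definition rademacher (k : nat) (x : dyadic) : R := (-1) ^+ x k.

(* An infinite product, only finitely many factors of which differ from 1. *)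
Definition walsh (m : nat) (x : dyadic) : R :=
  \big[*%R/1]_(k \in [set: nat]) rademacher k x ^+ digit m k.

Lemma walshE N m x : (m < 2 ^ N)%N ->
  walsh m x = \prod_(k < N) rademacher k x ^+ digit m k.
Proof.
move=> mN; rewrite (fsbig_ord _ N (fun k : nat => rademacher k x ^+ digit m k)); symmetry; apply: fsbig_widen => //.
move=> k [_ /=] /negP; rewrite -leqNgt => Nk.
rewrite /digit divn_small ?expr0 //.
by apply: leq_trans mN _; rewrite leq_pexp2l.
Qed.

Definition dirichlet (n : nat) (x : dyadic) : R := \sum_(0 <= k < n) walsh k x.

Definition fejer (n : nat) (x : dyadic) : R :=
  n%:R^-1 * \sum_(1 <= k < n.+1) dirichlet k x.

End Walsh.

(* Main.v *)
(* Let t = t_i and S_m = m K_m(x).  Since x vanishes on the first t+1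
   coordinates and x_{t+1} = x_{t+2} = 1, the sequence D_m(x), 0 <= m <= 2^(t+3),
   climbs to 2^(t+1) with slope 1, returns to 0, and then repeats this tent with
   the opposite sign.  Hence S_{2^(t+3)} = 0, and |S_m| depends only on m modulo
   2^(t+3).  The gap conditions say that bit t of n is 1 and bit t+1 is 0, so
   n mod 2^(t+3) is b or 2^(t+2) + b with 2^t <= b < 2^(t+1).  In the first case
   |S_n| = b(b+1)/2, in the second |S_n| = 2^(2t+2) - b(b+1)/2. *)
From mathcomp Require Import zify ring lra.
Require Import Defs.
Import Order.TTheory GRing.Theory Num.Theory.
Local Open Scope classical_set_scope.
Local Open Scope ring_scope.

(** * Carry-free addition for digits, Walsh functions and kernel sums *)

(** No carry occurs: [q * 2 ^ N] has only zero digits below position [N], and [j] only zero digits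
    from [N] on. *)
Lemma digit_addM N q j k : (j < 2 ^ N)%N ->
  digit (q * 2 ^ N + j) k = (digit (q * 2 ^ N) k + digit j k)%N.
Proof.
move=> jN; rewrite /digit; have [kN|Nk] := ltnP k N.
  have -> : (q * 2 ^ N = q * 2 ^ (N - k) * 2 ^ k)%N.
    by rewrite -mulnA -expnD subnK // ltnW.
  rewrite divnMDl ?expn_gt0 // mulnK ?expn_gt0 // oddD.
  by rewrite oddM oddX subn_eq0 leqNgt kN andbF.
rewrite (divn_small (leq_trans jN _)) ?leq_pexp2l // addn0.
rewrite -(subnKC Nk) expnD !divnMA divnMDl ?expn_gt0 // mulnK ?expn_gt0 //.
by rewrite (divn_small jN) addn0.
Qed.

Section FejerSum.
Variables (R : realType) (x : dyadic).

Local Notation w m := (walsh R m x).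
Local Notation D m := (dirichlet R m x).
Local Notation S m := (\sum_(1 <= k < m.+1) dirichlet R k x).

Lemma walsh_addM N q j : (j < 2 ^ N)%N ->
  w (q * 2 ^ N + j) = w (q * 2 ^ N) * w j.
Proof.
move=> jN; set M := (q * 2 ^ N + j)%N.
(* Since [a < 2 ^ a], the single width [M] serves all three indices. *)
have lM a : (a <= M)%N -> (a < 2 ^ M)%N by move/leq_ltn_trans; apply; apply: ltn_expl.
rewrite !(@walshE _ M) ?lM ?leq_addl ?leq_addr // -big_split /=.
by apply: eq_bigr => k _; rewrite digit_addM // exprD.
Qed.

Lemma walsh_exp2 k : w (2 ^ k) = rademacher R k x.
Proof.
rewrite (@walshE _ k.+1) ?ltn_exp2l // big_ord_recr /= big1 ?mul1r => [|i _].
  by rewrite /digit divnn expn_gt0 expr1.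
by rewrite /digit -expnB ?(ltnW (ltn_ord i)) // oddX subn_eq0 leqNgt ltn_ord expr0.
Qed.

Lemma walsh_eq1 N m : (forall k, (k < N)%N -> x k = 0) -> (m < 2 ^ N)%N ->
  w m = 1.
Proof.
move=> x0 mN; rewrite (walshE _ _ mN) big1 // => k _.
by rewrite /rademacher x0 // expr0 expr1n.
Qed.

Lemma normr_walsh m : `|w m| = 1.
Proof.
rewrite (walshE _ _ (ltn_expl m (ltnSn 1))) normr_prod big1 // => k _.
by rewrite /rademacher normrX normrX normrN1 !expr1n.
Qed.

Lemma dirichletS m : D m.+1 = D m + w m.
Proof. by rewrite /dirichlet big_nat_recr. Qed.

Lemma fejer_sumS m : S m.+1 = S m + D m.+1.
Proof. by rewrite big_nat_recr. Qed.

Lemma dirichlet_addM N q j : (j <= 2 ^ N)%N ->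
  D (q * 2 ^ N + j) = D (q * 2 ^ N) + w (q * 2 ^ N) * D j.
Proof.
elim: j => [|j IHj] jN.
  by rewrite addn0 [D 0]/dirichlet big_geq // mulr0 addr0.
by rewrite addnS !dirichletS IHj 1?ltnW // walsh_addM // mulrDr addrA.
Qed.

Lemma fejer_sum_addM N q j : (j <= 2 ^ N)%N ->
  S (q * 2 ^ N + j)%N =
    S (q * 2 ^ N)%N + j%:R * D (q * 2 ^ N) + w (q * 2 ^ N) * S j.
Proof.
elim: j => [|j IHj] jN; first by rewrite addn0 mul0r [S 0%N]big_geq // mulr0 !addr0.
rewrite addnS !fejer_sumS IHj 1?ltnW // -addnS dirichlet_addM // -natr1; ring.
Qed.

(** By the addition formulas, vanishing of [D] and [S] at [2 ^ N] propagates to all its multiples,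
    so only the Walsh factor survives. *)
Lemma fejer_sum_mod N q j : D (2 ^ N) = 0 -> S (2 ^ N)%N = 0 -> (j <= 2 ^ N)%N ->
  S (q * 2 ^ N + j)%N = w (q * 2 ^ N) * S j.
Proof.
move=> D0 S0 jN.
have Dq a : D (a * 2 ^ N) = 0.
  elim: a => [|a IHa]; first by rewrite /dirichlet big_geq.
  by rewrite mulSnr dirichlet_addM // IHa D0 mulr0 addr0.
have Sq : S (q * 2 ^ N)%N = 0.
  elim: (q) => [|a IHa]; first by rewrite big_geq.
  by rewrite mulSnr fejer_sum_addM // IHa S0 Dq !mulr0 !addr0.
by rewrite fejer_sum_addM // Sq Dq mulr0 !add0r.
Qed.

(** * Tent shape of the kernels at a point with [N] leading zeros followed by ones *)

Section Tent.
Variable N : nat.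
Hypothesis x0 : forall k, (k < N)%N -> x k = 0.

Lemma dirichlet_le j : (j <= 2 ^ N)%N -> D j = j%:R.
Proof.
elim: j => [|j IHj] jN; first by rewrite /dirichlet big_geq.
by rewrite dirichletS IHj 1?ltnW // (walsh_eq1 _ _ x0) // natr1.
Qed.

Lemma fejer_sum_le j : (j <= 2 ^ N)%N -> S j = j%:R * (j%:R + 1) / 2.
Proof.
elim: j => [|j IHj] jN; first by rewrite big_geq // !mul0r.
by rewrite fejer_sumS IHj 1?ltnW // dirichlet_le // -natr1; field.
Qed.

Hypothesis xN : x N = 1.

Lemma dirichlet_tent : D (2 ^ N.+1) = 0.
Proof.
have := @dirichlet_addM N 1 (2 ^ N) (leqnn _).
rewrite mul1n addnn -mul2n -expnS => ->.
by rewrite dirichlet_le // walsh_exp2 /rademacher xN expr1; ring.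
Qed.

(** As [w (2 ^ N) = -1], the triangular sums of the two halves cancel, leaving
    [2 ^ N * D (2 ^ N)]. *)
Lemma fejer_sum_tent : S (2 ^ N.+1)%N = 2 ^+ N.*2.
Proof.
have := @fejer_sum_addM N 1 (2 ^ N) (leqnn _).
rewrite mul1n addnn -mul2n -expnS => ->.
rewrite fejer_sum_le // dirichlet_le // walsh_exp2 /rademacher xN expr1.
by rewrite -addnn exprD natrX; field.
Qed.

Hypothesis xN1 : x N.+1 = 1.

Lemma dirichlet_double_tent : D (2 ^ N.+2) = 0.
Proof.
have := @dirichlet_addM N.+1 1 (2 ^ N.+1) (leqnn _).
by rewrite mul1n addnn -mul2n -expnS => ->; rewrite dirichlet_tent mulr0 addr0.
Qed.

Lemma fejer_sum_second_tent j : (j <= 2 ^ N.+1)%N ->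
  S (2 ^ N.+1 + j)%N = 2 ^+ N.*2 - S j.
Proof.
move=> jN; have := @fejer_sum_addM N.+1 1 j jN; rewrite mul1n => ->.
rewrite fejer_sum_tent dirichlet_tent walsh_exp2 /rademacher xN1 expr1; ring.
Qed.

Lemma fejer_sum_double_tent : S (2 ^ N.+2)%N = 0.
Proof.
rewrite [(2 ^ N.+2)%N]expnS mul2n -addnn fejer_sum_second_tent //.
by rewrite fejer_sum_tent subrr.
Qed.

(** Here [N] is [t + 1], so the target [2 ^ (2t - 2)] reads [2 ^ (2N) / 16]. *)
Lemma normr_fejer_sum_ge q b : (2 ^ N <= b.*2)%N -> (b < 2 ^ N)%N ->
  2 ^+ N.*2 / 16 <= `|S (q * 2 ^ N.+1 + b)%N|.
Proof.
move=> Nb bN.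
have bN1 : (b <= 2 ^ N.+1)%N by rewrite expnS; lia.
have reduce r j : (j <= 2 ^ N.+2)%N -> `|S (r * 2 ^ N.+2 + j)%N| = `|S j|.
  move=> jN; rewrite fejer_sum_mod ?dirichlet_double_tent ?fejer_sum_double_tent //.
  by rewrite normrM normr_walsh mul1r.
have Sb : S b = b%:R * (b%:R + 1) / 2 by rewrite fejer_sum_le // ltnW.
set y : R := 2 ^+ N; have Ey : 2 ^+ N.*2 = y * y :> R by rewrite -addnn exprD.
have yb : y <= 2 * b%:R by rewrite /y -natrX -natrM mul2n ler_nat.
have by1 : b%:R + 1 <= y by rewrite /y -natrX natr1 ler_nat.
have y0 : 0 < y by rewrite exprn_gt0.
(* The period is [2 ^ N.+2]; the parity of [q] tells in which of the two tents the remainder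
   lies. *)
have -> : (q * 2 ^ N.+1 + b = q./2 * 2 ^ N.+2 + (odd q * 2 ^ N.+1 + b))%N.
  by rewrite -{1}(odd_double_half q) [(2 ^ N.+2)%N]expnS; lia.
rewrite reduce; last first.
  by rewrite [(2 ^ N.+2)%N]expnS mul2n -addnn leq_add //; case: odd; rewrite ?mul1n.
(* For odd [q], [b (b + 1) <= y ^ 2] leaves at least [y ^ 2 / 2]; for even [q], [y <= 2 b] gives at
   least [y ^ 2 / 8]. *)
case: (odd q).
  by rewrite mul1n fejer_sum_second_tent // Sb Ey ger0_norm; nra.
by rewrite mul0n add0n Sb Ey ger0_norm; nra.
Qed.

End Tent.

End FejerSum.

(** * Position of the binary blocks of [n] *)

Lemma sum_exp2_nat l t : (l <= t)%N ->
  ((\sum_(l <= k < t) 2 ^ k) + 2 ^ l = 2 ^ t)%N.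
Proof.
move=> lt; rewrite -(subnKC lt); elim: (t - l)%N => [|d IHd].
  by rewrite addn0 big_geq.
by rewrite addnS big_nat_recr ?leq_addr //= expnS; lia.
Qed.

Section BinaryBlocks.
Variables (s : nat) (l t : nat -> nat).
Hypothesis hlt : forall i, (1 <= i <= s)%N -> (l i <= t i)%N.
Hypothesis hgap : forall i, (1 <= i < s)%N -> (t i.+1 + 2 <= l i)%N.

Local Notation block i := (\sum_(l i <= k < (t i).+1) 2 ^ k)%N.

(** Block [i] falls short of [2 ^ (t i).+1] by exactly [2 ^ l i], and by the gap the later blocks
    sum to less than that. *)
Lemma sum_blocks_lt i : (1 <= i <= s)%N ->
  (\sum_(i <= j < s.+1) block j < 2 ^ (t i).+1)%N.
Proof.
move: {2}(s - i)%N (erefl (s - i)%N) => d; elim: d i => [|d IHd] i sd hi.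
  have -> : i = s by lia.
  have hs : (1 <= s <= s)%N by lia.
  rewrite big_nat1 -(sum_exp2_nat _ _ (leqW (hlt _ hs))).
  by rewrite -[ltnLHS]addn0 ltn_add2l expn_gt0.
rewrite big_ltn; last by lia.
rewrite -(sum_exp2_nat _ _ (leqW (hlt _ hi))) ltn_add2l.
have gap : (t i.+1 + 2 <= l i)%N by apply: hgap; lia.
apply: leq_trans (IHd i.+1 _ _) _; [lia | lia |].
by rewrite leq_exp2l //; lia.
Qed.

(** Exponents in earlier blocks are at least [l (i - 1)], hence at least [t i + 2]. *)
Lemma exp2_dvd_sum_blocks i : (1 <= i <= s)%N ->
  (2 ^ (t i).+2 %| \sum_(1 <= j < i) block j)%N.
Proof.
elim: i => [|[|i] IHi] // hi; first by rewrite big_geq.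
have hi' : (1 <= i.+1 <= s)%N by lia.
have lti := hlt _ hi'; have := @hgap i.+1 hi => gap.
rewrite big_nat_recr //= dvdn_add //.
  by apply: dvdn_trans (IHi hi'); rewrite dvdn_exp2l //; lia.
rewrite big_seq; apply: dvdn_sum => k; rewrite mem_index_iota => hk.
by rewrite dvdn_exp2l //; lia.
Qed.

(** [q] collects the blocks before [i] and [b] the rest; the top term of block [i] bounds [b] from
    below. *)
Lemma sum_blocks_split i : (1 <= i <= s)%N ->
  exists q b, (\sum_(1 <= j < s.+1) block j = q * 2 ^ (t i).+2 + b)%N /\
    (2 ^ t i <= b < 2 ^ (t i).+1)%N.
Proof.
move=> hi; have /dvdnP[q hq] := exp2_dvd_sum_blocks _ hi.
exists q, (\sum_(i <= j < s.+1) block j)%N; split.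
  by rewrite -hq -big_cat_nat //=; lia.
rewrite sum_blocks_lt // andbT big_ltn; last by lia.
by rewrite big_nat_recr ?hlt //= -addnA addnCA leq_addr.
Qed.

End BinaryBlocks.

Theorem proposition1 (R : realType) (s n : nat) (l t : nat -> nat)
  (hs : (1 <= s)%N)
  (hlt : forall i : nat, (1 <= i <= s)%N -> (l i <= t i)%N)
  (hgap : forall i : nat, (1 <= i < s)%N -> (t i.+1 + 2 <= l i)%N)
  (hn : n = (\sum_(1 <= i < s.+1) \sum_(l i <= k < (t i).+1) 2 ^ k)%N) :
  forall i : nat, (1 <= i <= s)%N ->
  forall x : dyadic,
    x \in dyadic_itv (t i + 3) (dyadic_unit (t i + 1) + dyadic_unit (t i + 2)) ->
    n%:R * `|fejer R n x| >= 2 ^ ((2 * t i)%:Z - 2).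
Proof.
move=> i hi x; rewrite inE /dyadic_itv /= => hx.
have [q [b [nE /andP[tb bt]]]] := sum_blocks_split s l t hlt hgap i hi.
rewrite -hn in nE.
have xE j : (j < t i + 3)%N ->
    x j = (j == t i + 1)%N%:R + (j == t i + 2)%N%:R by move=> /hx ->.
have x0 k : (k < (t i).+1)%N -> x k = 0.
  move=> hk; rewrite xE; last by lia.
  have -> : (k == t i + 1)%N = false by lia.
  have -> : (k == t i + 2)%N = false by lia.
  exact: addr0.
have x1 : x (t i).+1 = 1.
  rewrite xE; last by lia.
  have -> : ((t i).+1 == t i + 1)%N by lia.
  have -> : ((t i).+1 == t i + 2)%N = false by lia.
  exact: addr0.
have x2 : x (t i).+2 = 1.
  rewrite xE; last by lia.
  have -> : ((t i).+2 == t i + 1)%N = false by lia.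
  have -> : ((t i).+2 == t i + 2)%N by lia.
  exact: add0r.
(* [n >= b >= 2 ^ t i > 0], so the factor [1 / n] in [fejer] really cancels. *)
have n0 : n%:R != 0 :> R.
  rewrite pnatr_eq0 nE -lt0n addn_gt0 orbC (leq_trans _ tb) //.
  by rewrite expn_gt0.
rewrite /fejer normrM normfV normr_nat mulVKf // nE.
have tb2 : (2 ^ (t i).+1 <= b.*2)%N by rewrite expnS mul2n leq_double.
apply: le_trans (normr_fejer_sum_ge R x _ x0 x1 x2 q b tb2 bt).
(* The exponent is an integer, negative when [t i = 0]; the two bounds are in fact equal. *)
rewrite expfzDr ?pnatr_eq0 // -exprnP -[X in _ * X]/(2 ^- 2) doubleS -mul2n !exprS.
by rewrite le_eqVlt; apply/orP; left; apply/eqP; field.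
Qed.
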